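(* Consider the following algorithm. Input: a subcube partition $F=\{s_1,\dots,s_m\}$ of $\{0,1\}^n$ (subcubes given as words in $\{0,1,*\}^n$). For each pair $1\le i<j\le m$: set $G\gets\{s_i,s_j\}$; while some $s_k\notin G$ intersects $\bigvee G$, set $G\gets G\cup\{s_k\}$; when the loop ends, if $G\ne F$, return ''Reducible: $\bigcup G$ is a subcube''. If no pair triggers a return, return ''Irreducible''. Then this algorithm runs in time polynomial in $n$ and $m$, and its output is correct: it outputs ''Reducible'' (together with a set $G\subseteq F$, $1<|G|<|F|$, whose union is a subcube) if and only if $F$ is reducible, and outputs ''Irreducible'' otherwise.
   Context: A subcube of $\{0,1\}^n$ is a set of the form $\{x\in\{0,1\}^n: x_{i_1}=b_1,\dots,x_{i_d}=b_d\}$, identified with a word $s\in\{0,1,*\}^n$ where $s_i=*$ means coordinate $i$ is unconstrained. A subcube partition of length $n$ is a partition of $\{0,1\}^n$ into subcubes. It is reducible if there is $G\subset F$ with $1<|G|<|F|$ whose union is a subcube, and irreducible otherwise. The join $s\vee t$ of subcubes $s,t$ is the smallest subcube containing both: $(s\vee t)_i=b$ if $s_i=t_i=b\in\{0,1\}$ and $*$ otherwise; $\bigvee G$ is the join of all subcubes in $G$. Two subcubes intersect iff there is no coordinate $i$ with $s_i,t_i\ne *$ and $s_i\ne t_i$. *)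

(* Defs.v *)
From mathcomp Require Import all_boot all_order all_algebra.

Set Implicit Arguments.
Unset Strict Implicit.
Unset Printing Implicit Defensive.

Import GRing.Theory.

(* Subcubes as words over {0, 1, *}; [None] is the star. *)

Definition point (n : nat) := n.-tuple bool.
Definition word (n : nat) := n.-tuple (option bool).

Definition subcube n (s : word n) : {set point n} :=
  [set x | [forall i, if tnth s i is Some b then tnth x i == b else true]].

Definition is_subcube n (A : {set point n}) : Prop :=
  exists s : word n, A = subcube s.

(* Distinct words denote distinct, nonempty subcubes, so a set of subcubes is
   the same thing as a set of words. *)
Definition subcube_partition n (F : {set word n}) : bool :=
  partition [set subcube s | s in F] [set: point n].

Definition reduces n (F G : {set word n}) : Prop :=
  [/\ G \subset F, 1 < #|G| < #|F| & is_subcube (\bigcup_(s in G) subcube s)].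

Definition reducible n (F : {set word n}) : Prop := exists G, reduces F G.

Definition irreducible n (F : {set word n}) : Prop := ~ reducible F.

(* Model of computation: a random-access machine with a read-only input table,
   finitely many registers and one-dimensional arrays.  The only arithmetic is
   the successor, so that unit cost is realistic: a register never exceeds the
   input parameters, the constants of the program and the number of steps.
   Since a program is a fixed text, the expressions that it evaluates in one
   step have bounded size. *)

Inductive reg := Rn | Rm | Ri | Rj | Rk | Rl | Rfound | Rpick | Rmeet | Rproper.
Inductive arr := AG | AJ.

Definition reg_eq_dec (x y : reg) : {x = y} + {x <> y}.
Proof. decide equality. Defined.

Definition arr_eq_dec (a b : arr) : {a = b} + {a <> b}.
Proof. decide equality. Defined.

Inductive expr :=
| Const of nat
| Var of reg
| Succ of expr
| Cell of arr & expr
| Input of expr & expr.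

Inductive test :=
| Eq of expr & expr
| Lt of expr & expr
| Not of test
| And of test & test.

(* [Choice] is a nondeterministic branching; [Return] stops the whole
   program. *)
Inductive cmd :=
| Skip
| Return of bool
| Assign of reg & expr
| Store of arr & expr & expr
| Seq of cmd & cmd
| If of test & cmd & cmd
| While of test & cmd
| Choice of cmd & cmd.

Record state := State { regs : reg -> nat; cells : arr -> nat -> nat }.

Definition set_reg (st : state) (x : reg) (v : nat) : state :=
  State (fun y => if reg_eq_dec y x then v else regs st y) (cells st).

Definition set_cells (st : state) (a : arr) (p v : nat) : state :=
  State (regs st) (fun b q => if arr_eq_dec b a then
                                (if q == p then v else cells st b q)
                              else cells st b q).

Fixpoint eval (inp : nat -> nat -> nat) (st : state) (e : expr) : nat :=
  match e with
  | Const c => c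
  | Var x => regs st x
  | Succ e1 => (eval inp st e1).+1
  | Cell a e1 => cells st a (eval inp st e1)
  | Input e1 e2 => inp (eval inp st e1) (eval inp st e2)
  end.

Fixpoint holds (inp : nat -> nat -> nat) (st : state) (b : test) : bool :=
  match b with
  | Eq e1 e2 => eval inp st e1 == eval inp st e2
  | Lt e1 e2 => eval inp st e1 < eval inp st e2
  | Not b1 => ~~ holds inp st b1
  | And b1 b2 => holds inp st b1 && holds inp st b2
  end.

(* The bit [o] resolves the choice, if the step is one.  [Skip] and [Return]
   are the halted programs. *)
Fixpoint step (inp : nat -> nat -> nat) (o : bool) (c : cmd) (st : state) :
    cmd * state :=
  match c with
  | Skip => (Skip, st)
  | Return r => (Return r, st)
  | Assign x e => (Skip, set_reg st x (eval inp st e))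
  | Store a e1 e2 => (Skip, set_cells st a (eval inp st e1) (eval inp st e2))
  | Seq Skip c2 => (c2, st)
  | Seq (Return r) _ => (Return r, st)
  | Seq c1 c2 => let: (c1', st') := step inp o c1 st in (Seq c1' c2, st')
  | If b c1 c2 => (if holds inp st b then c1 else c2, st)
  | While b c1 => (if holds inp st b then Seq c1 c else Skip, st)
  | Choice c1 c2 => (if o then c1 else c2, st)
  end.

(* The configuration after [t] steps; [o] resolves the choices, so that the
   executions of a program are the [run inp o] for all [o]. *)
Fixpoint run (inp : nat -> nat -> nat) (o : nat -> bool) (t : nat)
    (c : cmd * state) : cmd * state :=
  if t is t'.+1 then
    let: (c', st') := run inp o t' c in step inp (o t') c' st'
  else c.

(* The algorithm.  Indices start at 0; [AG] holds the indicator of G among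
   s_0, ..., s_(m-1), [AJ] holds the word of the join of G, and the letters
   0, 1, * are coded 0, 1, 2. *)

Notation "c1 ;; c2" := (Seq c1 c2) (at level 60, right associativity).
Notation "x ::= e" := (Assign x e) (at level 55).

Coercion Var : reg >-> expr.
Coercion Const : nat >-> expr.

Definition For (x : reg) (e0 e : expr) (c : cmd) : cmd :=
  x ::= e0;; While (Lt x e) (c;; x ::= Succ x).

(* G <- {s_i, s_j} *)
Definition init_G : cmd :=
  For Rk 0 Rm (Store AG Rk 0);; Store AG Ri 1;; Store AG Rj 1.

(* The join is accumulated starting from s_i, which is always in G. *)
Definition join_G : cmd :=
  For Rl 0 Rn (Store AJ Rl (Input Ri Rl));;
  For Rk 0 Rm
    (If (Eq (Cell AG Rk) 1)
       (For Rl 0 Rn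
          (If (Eq (Cell AJ Rl) (Input Rk Rl)) Skip (Store AJ Rl 2)))
       Skip).

(* [Rmeet] tells whether s_k intersects the join of G. *)
Definition meets_join : cmd :=
  Rmeet ::= 1;;
  For Rl 0 Rn
    (If (And (And (Not (Eq (Cell AJ Rl) 2)) (Not (Eq (Input Rk Rl) 2)))
             (Not (Eq (Cell AJ Rl) (Input Rk Rl))))
       (Rmeet ::= 0) Skip).

(* [Rfound] tells whether some s_k outside G intersects the join of G; if so,
   [Rpick] is the index of any one of them, chosen nondeterministically. *)
Definition find_s : cmd :=
  Rfound ::= 0;;
  For Rk 0 Rm
    (If (Eq (Cell AG Rk) 0)
       (meets_join;;
        If (Eq Rmeet 1)
          (If (Eq Rfound 0)
             (Rfound ::= 1;; Rpick ::= Rk)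
             (Choice Skip (Rpick ::= Rk)))
          Skip)
       Skip).

Definition close_G : cmd :=
  join_G;; find_s;;
  While (Eq Rfound 1) (Store AG Rpick 1;; join_G;; find_s).

(* if G <> F, return "Reducible" *)
Definition check_G : cmd :=
  Rproper ::= 0;;
  For Rk 0 Rm (If (Eq (Cell AG Rk) 0) (Rproper ::= 1) Skip);;
  If (Eq Rproper 1) (Return true) Skip.

Definition algorithm : cmd :=
  For Ri 0 Rm
    (For Rj (Succ Ri) Rm
       (init_G;; close_G;; check_G));;
  Return false.

(* Input and output. *)

Definition code (a : option bool) : nat := if a is Some b then b else 2.

Definition input n m (w : m.-tuple (word n)) (k l : nat) : nat :=
  code (nth None (nth [::] [seq tval s | s <- w] k) l).

Definition start (n m : nat) : cmd * state :=
  (algorithm,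
   State (fun x => match x with Rn => n | Rm => m | _ => 0 end) (fun _ _ => 0)).

Definition exec n m (w : m.-tuple (word n)) (o : nat -> bool) (t : nat) :
    cmd * state :=
  run (input w) o t (start n m).

Variant answer (n : nat) := Reducible of {set word n} | Irreducible.
Arguments Irreducible {n}.

(* [None] for a configuration that has not returned. *)
Definition output n m (w : m.-tuple (word n)) (c : cmd * state) :
    option (answer n) :=
  match c.1 with
  | Return true =>
      Some (Reducible [set tnth w k | k : 'I_m & cells c.2 AG k == 1])
  | Return false => Some Irreducible
  | _ => None
  end.

(* Main.v *)
(** If [i] and [j] belong to a set [H] of cubes whose union is a subcube, that
    subcube contains the join of every [G] included in [H]; a cube of the
    partition meeting this join meets the union of [H], hence belongs to [H] by
    disjointness.  So the loop computes, whatever its choices, a [G] included in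
    every such [H].  When it stops, the cubes that meet the join of [G] are those
    of [G], which therefore cover it: the union of [G] is its join.  The partition
    is thus reducible iff some pair ends with [G <> F].  As for the running time,
    every execution of a loop of the program makes at most [n + m] iterations, and
    under this assumption a cost polynomial in [n + m] can be read off the text of
    the program. *)

Require Import Defs.
From mathcomp Require Import all_boot all_order all_algebra.
From mathcomp Require Import zify.
Import GRing.Theory.

Set Implicit Arguments.
Unset Strict Implicit.
Unset Printing Implicit Defensive.

(** * Timed total correctness *)

Section Logic.

Variable inp : nat -> nat -> nat.
Implicit Types (c : cmd) (st : state) (Q : state -> Prop)
  (R : bool -> state -> Prop).

(* A halted program steps to itself, so "after [T] steps" means "within [T]
   steps". *)
Fixpoint ensures T c st Q R : Prop :=
  if T is T'.+1 then
    forall o, ensures T' (step inp o c st).1 (step inp o c st).2 Q R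
  else match c with Skip => Q st | Return r => R r st | _ => False end.

Lemma ensures_Skip T st Q R : ensures T Skip st Q R <-> Q st.
Proof. by elim: T => //= T IH; split=> [/(_ true) /IH | /IH]. Qed.

Lemma ensures_Return T r st Q R : ensures T (Return r) st Q R <-> R r st.
Proof. by elim: T => //= T IH; split=> [/(_ true) /IH | /IH]. Qed.

Lemma ensures_conseq T T' c st Q Q' R R' :
    T <= T' -> (forall st', Q st' -> Q' st') ->
    (forall r st', R r st' -> R' r st') ->
  ensures T c st Q R -> ensures T' c st Q' R'.
Proof.
move=> leT QQ' RR'; elim: T T' leT c st => [|T IH] T' leT c st.
  case: c => //= [/QQ'|r /RR'] H; first exact/ensures_Skip.
  exact/ensures_Return.
by case: T' leT => // T' leT H o; apply: IH.
Qed.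

Lemma ensures_step T c st Q R :
  (forall o, ensures T (step inp o c st).1 (step inp o c st).2 Q R) ->
  ensures T.+1 c st Q R.
Proof. by []. Qed.

(** The [Seq] clause of [step] branches on the shape of [c1]; its cases are gathered here into the
    three that matter for an induction. *)
Lemma step_Seq o c1 c2 st :
  [\/ c1 = Skip, exists r, c1 = Return r
    | step inp o (Seq c1 c2) st =
      (Seq (step inp o c1 st).1 c2, (step inp o c1 st).2)].
Proof.
have stepE : match c1 with Skip | Return _ => True | _ =>
    step inp o (Seq c1 c2) st =
    let: (c1', st') := step inp o c1 st in (Seq c1' c2, st') end by case: c1.
case: (step inp o c1 st) stepE => c' st'; case: c1 => *;
  by [constructor 1 | constructor 2; eexists | constructor 3].
Qed.

(** The extra step pays for discarding the [Skip] left by [c1]. An early [Return] bypasses [c2],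
    hence the same [R] for both parts. *)
Lemma ensures_Seq T1 T2 c1 c2 st Q R :
    ensures T1 c1 st (fun st' => ensures T2 c2 st' Q R) R ->
  ensures (T1 + T2).+1 (Seq c1 c2) st Q R.
Proof.
elim: T1 c1 st => [|T1 IH] c1 st.
  by case: c1 => //= r H _; apply/ensures_Return.
move=> H; apply: ensures_step => o.
case: (step_Seq o c1 c2 st) => [c1E|[r c1E]|->].
- move: H; rewrite c1E => /ensures_Skip.
  by apply: ensures_conseq => //; rewrite leq_addl.
- by move: H; rewrite c1E => /ensures_Return ?; apply/ensures_Return.
by rewrite addSn; apply: IH; apply: H.
Qed.

Lemma ensures_run T c st Q R (o : nat -> bool) : ensures T c st Q R ->
  let: (c', st') := run inp o T (c, st) in
  match c' with Skip => Q st' | Return r => R r st' | _ => False end.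
Proof.
(* [run] unfolds at its last step and [ensures] at its first, so a step is moved to the front and
   the oracle shifted by one. *)
have run_front o' t cs :
    run inp o' t.+1 cs = run inp (o' \o succn) t (step inp (o' 0) cs.1 cs.2).
  elim: t => [|t IH]; first by case: cs.
  by rewrite -[LHS]/(let: (c', st') := run inp o' t.+1 cs in
                     step inp (o' t.+1) c' st') IH.
elim: T c st o => [|T IH] c st o //.
rewrite run_front => /(_ (o 0)) /= H.
by case: (step _ _ _ _) H => c' st' /IH; apply.
Qed.

Arguments ensures : simpl never.

(** * Frame conditions *)

Fixpoint writes_reg c (x : reg) : bool :=
  match c with
  | Assign y _ => if reg_eq_dec x y then true else false
  | Seq c1 c2 | If _ c1 c2 | Defs.Choice c1 c2 => writes_reg c1 x || writes_reg c2 x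
  | While _ c1 => writes_reg c1 x
  | _ => false
  end.

Fixpoint writes_arr c (a : arr) : bool :=
  match c with
  | Store b _ _ => if arr_eq_dec a b then true else false
  | Seq c1 c2 | If _ c1 c2 | Defs.Choice c1 c2 => writes_arr c1 a || writes_arr c2 a
  | While _ c1 => writes_arr c1 a
  | _ => false
  end.

(** Writes are tracked syntactically, and per whole array, so that side conditions about concrete
    programs hold by computation. *)
Definition unchanged c st st' : Prop :=
  (forall x, ~~ writes_reg c x -> regs st' x = regs st x) /\
  (forall a, ~~ writes_arr c a -> cells st' a =1 cells st a).

Lemma unchanged_trans c st1 st2 st3 :
  unchanged c st1 st2 -> unchanged c st2 st3 -> unchanged c st1 st3.
Proof.
move=> [r12 a12] [r23 a23]; split=> [x nw|a nw p]; first by rewrite r23 ?r12.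
by rewrite a23 ?a12.
Qed.

Lemma unchanged_sub c c' st st' :
    (forall x, writes_reg c x -> writes_reg c' x) ->
    (forall a, writes_arr c a -> writes_arr c' a) ->
  unchanged c st st' -> unchanged c' st st'.
Proof.
move=> sr sa [ur ua]; split=> [x|a] nw; first by apply/ur/(contra _ nw)/sr.
exact/ua/(contra _ nw)/sa.
Qed.

(** A residual program writes nothing that the original does not; this carries the frame through an
    induction on the steps. *)
Lemma step_writes o c st :
  [/\ unchanged c st (step inp o c st).2,
      forall x, writes_reg (step inp o c st).1 x -> writes_reg c x
    & forall a, writes_arr (step inp o c st).1 a -> writes_arr c a].
Proof.
elim: c => [|r|x e|a e1 e2|c1 [U sr sa] c2 _|b c1 _ c2 _|b c _|c1 _ c2 _] /=.
- by [].
- by [].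
- by split=> //; split=> //= y; case: reg_eq_dec.
- by split=> //; split=> //= b nw p; case: (arr_eq_dec b a) nw.
- rewrite -/(step inp o (Seq c1 c2) st).
  case: (step_Seq o c1 c2 st) => [->|[r ->]|->] /=.
  + by split=> // x ->; rewrite orbT.
  + by [].
  split=> [|x|a].
  + by apply: unchanged_sub U => /= [x|a] ->.
  + by case/orP=> [/sr|] ->; rewrite ?orbT.
  + by case/orP=> [/sa|] ->; rewrite ?orbT.
- by case: holds; split=> //= x ->; rewrite ?orbT.
- by case: holds; split=> //= x; rewrite orbb.
- by case: o; split=> //= x ->; rewrite ?orbT.
Qed.

Lemma ensures_frame T c st Q R : ensures T c st Q R ->
  ensures T c st (fun st' => Q st' /\ unchanged c st st') R.
Proof.
elim: T c st => [|T IH] c st; first by case: c.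
move=> H; apply: ensures_step => o; have [U sr sa] := step_writes o c st.
apply: ensures_conseq (IH _ _ (H o)) => // st' [HQ U']; split=> //.
exact/(unchanged_trans U)/(unchanged_sub sr sa).
Qed.

(* A bound on the running time when no execution of a loop iterates more than
   [N] times. *)
Fixpoint cost N c : nat :=
  match c with
  | Skip | Return _ => 0
  | Assign _ _ | Store _ _ _ => 1
  | Seq c1 c2 | If _ c1 c2 | Defs.Choice c1 c2 => (cost N c1 + cost N c2).+1
  | While _ c1 => N * (cost N c1).+2 + 1
  end.

Variable N : nat.

(* Not a definition, so that [apply:] does not unfold it to a product. *)
Variant wp c st Q R : Prop := Wp of ensures (cost N c) c st Q R.

Lemma wp_conseq c st Q Q' R R' :
    (forall st', Q st' -> Q' st') -> (forall r st', R r st' -> R' r st') ->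
  wp c st Q R -> wp c st Q' R'.
Proof. by move=> HQ HR [H]; split; apply: ensures_conseq H. Qed.

Lemma wp_frame c st Q R :
  wp c st Q R -> wp c st (fun st' => Q st' /\ unchanged c st st') R.
Proof. by case=> H; split; apply: ensures_frame. Qed.

Lemma wp_run c st Q R (o : nat -> bool) : wp c st Q R ->
  let: (c', st') := run inp o (cost N c) (c, st) in
  match c' with Skip => Q st' | Return r => R r st' | _ => False end.
Proof. by case; apply: ensures_run. Qed.

Lemma wp_Skip st Q R : Q st -> wp Skip st Q R.
Proof. by []. Qed.

Lemma wp_Return r st Q R : R r st -> wp (Return r) st Q R.
Proof. by []. Qed.

Lemma wp_Assign x e st Q R :
  Q (set_reg st x (eval inp st e)) -> wp (Assign x e) st Q R.
Proof. by split; apply: ensures_step. Qed.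

Lemma wp_Store a e1 e2 st Q R :
  Q (set_cells st a (eval inp st e1) (eval inp st e2)) ->
  wp (Store a e1 e2) st Q R.
Proof. by split; apply: ensures_step. Qed.

Lemma wp_Seq c1 c2 st Q R :
  wp c1 st (fun st' => wp c2 st' Q R) R -> wp (Seq c1 c2) st Q R.
Proof.
case=> H; split; apply: ensures_Seq; apply: ensures_conseq H => // st'.
by case.
Qed.

Lemma wp_If b c1 c2 st Q R :
    (holds inp st b -> wp c1 st Q R) -> (~~ holds inp st b -> wp c2 st Q R) ->
  wp (If b c1 c2) st Q R.
Proof.
move=> H1 H2; split; apply: ensures_step => o /=.
by case: ifPn => [/H1|/H2] []; apply: ensures_conseq => //;
  rewrite ?leq_addr ?leq_addl.
Qed.

(** The oracle may resolve the branching either way, so both branches must be correct; the cost of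
    the choice dominates that of each. *)
Lemma wp_Choice c1 c2 st Q R :
  wp c1 st Q R -> wp c2 st Q R -> wp (Defs.Choice c1 c2) st Q R.
Proof.
move=> [H1] [H2]; split; apply: ensures_step => -[] /=; [move: H1 | move: H2];
  by apply: ensures_conseq => //; rewrite ?leq_addr ?leq_addl.
Qed.

(* [I v] is the loop invariant when at most [v] iterations remain. *)
Lemma wp_While (I : nat -> state -> Prop) v b c st R :
    v <= N -> I v st ->
    (forall u st', u <= v -> I u st' -> holds inp st' b ->
       0 < u /\ wp c st' (I u.-1) R) ->
  wp (While b c) st (fun st' => (exists u, I u st') /\ ~~ holds inp st' b) R.
Proof.
move=> vN Iv Ic; set Q := fun st' => _.
(* An iteration costs one step for the test, the body, and one step to drop the final [Skip] of the
   body; the last [1] is the failing test. *)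
suff H u st' : u <= v -> I u st' ->
    ensures (u * (cost N c).+2 + 1) (While b c) st' Q R.
  by split; apply: ensures_conseq (H v st (leqnn _) Iv);
    rewrite //= leq_add2r leq_mul2r vN orbT.
elim: u st' => [|u IH] st' uv Iu; rewrite addn1; apply: ensures_step => o /=.
  case: ifPn => hb; last by apply/ensures_Skip; split=> //; exists 0.
  by have [] := Ic _ _ uv Iu hb.
case: ifPn => hb; last by apply/ensures_Skip; split=> //; exists u.+1.
have [_ [H]] := Ic _ _ uv Iu hb.
have -> : u.+1 * (cost N c).+2 = (cost N c + (u * (cost N c).+2 + 1)).+1.
  by lia.
apply: ensures_Seq; apply: ensures_conseq H => // st'' Iu'.
by apply: IH => //; apply: ltnW.
Qed.

(** The invariant is indexed by the counter, whose increment is built in, and the frame is supplied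
    both to the body and at the exit. As the body leaves the counter alone and the loop leaves [y]
    alone, [m - lo] bounds the number of iterations. *)
Lemma wp_For (I : nat -> state -> Prop) x y e0 c st lo m Q R :
    eval inp st e0 = lo -> regs st y = m -> lo <= m <= N ->
    ~~ writes_reg c x -> ~~ writes_reg (For x e0 y c) y ->
    I lo (set_reg st x lo) ->
    (forall st', unchanged (For x e0 y c) st st' -> I m st' -> Q st') ->
    (forall (k : 'I_m) st', lo <= k -> unchanged (For x e0 y c) st st' ->
       regs st' x = k -> I k st' ->
       wp c st' (fun st'' => I k.+1 (set_reg st'' x k.+1)) R) ->
  wp (For x e0 y c) st Q R.
Proof.
move=> e0E ym /andP[lo_m mN] nwx nwy Ilo IQ Ic.
suff: wp (For x e0 y c) st (I m) R.
  by move/wp_frame; apply: wp_conseq => // st' [Im U]; apply: IQ U Im.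
apply: wp_Seq; apply: wp_Assign; rewrite e0E.
set J := fun u st' => exists k, [/\ u + k = m, lo <= k, regs st' x = k,
  I k st' & unchanged (For x e0 y c) st st'].
have yE st' : unchanged (For x e0 y c) st st' -> regs st' y = m.
  by case=> + _; rewrite -ym; apply.
have wx : writes_reg (For x e0 y c) x by rewrite /=; case: reg_eq_dec.
have Us st' v : unchanged (For x e0 y c) st st' ->
    unchanged (For x e0 y c) st (set_reg st' x v).
  move=> [Ur Ua]; split=> [z nwz /=|]; last exact: Ua.
  case: (reg_eq_dec z x) => [zx|/= _]; last exact: Ur.
  by rewrite zx wx in nwz.
have W := @wp_While J (m - lo) (Lt x y) (c;; x ::= Succ x) (set_reg st x lo) R.
apply: wp_conseq (W _ _ _) => [st'|//|||].
- move=> [[u [k [ukm _ xk Ik /yE yk]]]] /=; rewrite yk xk => km.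
  by have -> : m = k by lia.
- by lia.
- exists lo; split=> //; [lia | | exact: Us].
  by rewrite /=; case: reg_eq_dec.
move=> u st' uv [k [ukm lok xk Ik U]] /=; rewrite xk (yE _ U) => km.
split; first by lia.
apply: wp_Seq; have := wp_frame (Ic (Ordinal km) st' lok U xk Ik).
apply: wp_conseq => // st'' [Ik' U'].
apply: wp_Assign => /=.
have -> : regs st'' x = k by rewrite -xk; apply: U'.1.
exists k.+1; split=> //; first by lia.
- by rewrite ltnW.
- by rewrite /=; case: (reg_eq_dec x x).
apply: Us; apply: (unchanged_trans U).
by apply: unchanged_sub U' => [z|a] /= ->; rewrite ?orbT.
Qed.

End Logic.

(** By structural induction: with iteration bound [n + m], a loop multiplies the polynomial of its
    body by a linear one, up to additive constants. *)
Lemma cost_poly c : exists p : {poly {poly nat}},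
  forall n m, cost (n + m) c = p.[n%:P].[m]%R.
Proof.
elim: c => [|r|x e|a e1 e2|c1 [p1 H1] c2 [p2 H2]|b c1 [p1 H1] c2 [p2 H2]
  |b c [p H]|c1 [p1 H1] c2 [p2 H2]] /=.
1,2: by exists 0%R => n m; rewrite !horner0.
1,2: by exists 1%R => n m; rewrite !hornerC.
1,2,4: by exists (p1 + p2 + 1)%R => n m; rewrite !hornerD !hornerC -H1 -H2 -addn1.
(* The outer indeterminate becomes [n] and the inner one [m], so the first factor evaluates to
   [n + m]. *)
exists (('X + 'X%:P) * (p + 2%:R) + 1)%R => n m.
have -> : (cost (n + m) c).+2 = cost (n + m) c + 2 by rewrite addn2.
rewrite hornerD hornerM !hornerD !hornerX !hornerC.
by rewrite hornerM !hornerD hornerX !hornerC -H.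
Qed.

(** * Joins of subcubes *)

Section Subcubes.

Variable n : nat.
Implicit Types s t : word n.

Lemma subcubeP s (x : point n) :
  reflect (forall l b, tnth s l = Some b -> tnth x l = b) (x \in subcube s).
Proof.
rewrite inE; apply: (iffP forallP) => [H l b sl|H l].
  by have := H l; rewrite sl => /eqP.
by case sl: (tnth s l) => [b|] //; apply/eqP/H.
Qed.

Lemma subcube_subset s t :
  reflect (forall l b, tnth t l = Some b -> tnth s l = Some b)
    (subcube s \subset subcube t).
Proof.
apply: (iffP subsetP) => [st l b tl|H x /subcubeP xs]; last first.
  by apply/subcubeP=> l b /H /xs.
(* This point of [s] has the bit opposite to [b] at every free coordinate, so its lying in [t]
   forces [s] to be fixed at [l]. *)
pose x : point n := [tuple odflt (~~ b) (tnth s i) | i < n].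
have /st/subcubeP/(_ l b tl) : x \in subcube s.
  by apply/subcubeP=> i c si; rewrite tnth_mktuple si.
by rewrite tnth_mktuple; case: (tnth s l) => [c <-|] //=; case: (b).
Qed.

Lemma subcube_inj : injective (@subcube n).
Proof.
move=> s t st; apply: eq_from_tnth => l.
have /subcube_subset ts : subcube t \subset subcube s by rewrite st.
have {st}/subcube_subset st : subcube s \subset subcube t by rewrite st.
case sl: (tnth s l) => [b|]; first by rewrite (ts _ _ sl).
by case tl: (tnth t l) => [b|] //; rewrite -sl (st _ _ tl).
Qed.

Definition compatible s t : bool :=
  [forall l, [|| tnth s l == None, tnth t l == None | tnth s l == tnth t l]].

Lemma compatibleP s t :
  reflect (exists2 x, x \in subcube s & x \in subcube t) (compatible s t).
Proof.
apply: (iffP forallP) => [H|[x /subcubeP xs /subcubeP xt] l].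
  (* The common point copies [s] where [s] is fixed, then [t], and is [true] where both are free. *)
  exists [tuple odflt (odflt true (tnth t i)) (tnth s i) | i < n];
    apply/subcubeP=> l b el; rewrite tnth_mktuple.
    by rewrite el.
  by have := H l; rewrite el /=; case: (tnth s l) => [c|] //= /eqP[].
case sl: (tnth s l) => [b|] //=; case tl: (tnth t l) => [c|] //=.
by rewrite -(xs _ _ sl) -(xt _ _ tl).
Qed.

Variables (m : nat) (w : m.-tuple (word n)).
Local Notation s_ := (tnth w).
Implicit Types G H : {set 'I_m}.

Definition union G : {set point n} := \bigcup_(k in G) subcube (s_ k).

(* For empty [G] this is a junk value. *)
Definition join G : word n :=
  [tuple [pick b | [forall k in G, tnth (s_ k) l == Some b]] | l < n].

(** With [G] nonempty, a bit common to all members is unique, so the choice made by [pick] is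
    harmless. *)
Lemma joinP G l b : G != set0 ->
  tnth (join G) l = Some b <-> {in G, forall k, tnth (s_ k) l = Some b}.
Proof.
case/set0Pn=> k kG; rewrite tnth_mktuple; case: pickP => [c|no].
  move/forall_inP => H; split=> [[<-] j /H/eqP // | /(_ k kG)].
  by rewrite (eqP (H k kG)).
split=> // H; have /forall_inP[] := no b => j /H ->; exact: eqxx.
Qed.

(** This is the update made by the inner loop of [join_G]: a coordinate is starred as soon as the
    new cube disagrees there. *)
Lemma joinU1 G k l : G != set0 ->
  tnth (join (k |: G)) l =
  if tnth (join G) l == tnth (s_ k) l then tnth (join G) l else None.
Proof.
move=> G0; have kG0 : k |: G != set0 by apply/set0Pn; exists k; rewrite setU11.
have H b : tnth (join (k |: G)) l = Some b <->
    tnth (s_ k) l = Some b /\ tnth (join G) l = Some b.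
  rewrite !joinP //; split=> [H|[kb Gb] j /setU1P[->|/Gb] //].
  by split=> [|j jG]; apply: H; rewrite !inE ?eqxx ?jG ?orbT.
case E: (tnth (join (k |: G)) l) => [b|].
  by have [-> ->] := (H b).1 E; rewrite eqxx.
case: eqP => // jk; case j: (tnth (join G) l) => [b|] //.
by rewrite -E; apply/H; rewrite -jk.
Qed.

Lemma join1 k : join [set k] = s_ k.
Proof.
have k0 : [set k] != set0 by apply/set0Pn; exists k; rewrite set11.
apply: eq_from_tnth => l; case E: (tnth (s_ k) l) => [b|].
  by apply/joinP => // j /set1P ->.
case J: (tnth _ l) => [b|] //.
by have /(_ k) := (joinP l b k0).1 J; rewrite set11 E => /(_ isT).
Qed.

Lemma sub_join G k : k \in G -> subcube (s_ k) \subset subcube (join G).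
Proof.
move=> kG; apply/subcube_subset => l b /joinP; apply=> //.
by apply/set0Pn; exists k.
Qed.

Lemma join_sub G t : G != set0 -> union G \subset subcube t ->
  subcube (join G) \subset subcube t.
Proof.
move=> G0 /bigcupsP Gt; apply/subcube_subset => l b tl; apply/joinP => // k kG.
exact/(subcube_subset _ _ (Gt k kG)).
Qed.

Definition join_closed G : Prop :=
  forall k, compatible (join G) (s_ k) -> k \in G.

Hypothesis tiling : forall x, exists k, forall j, (x \in subcube (s_ j)) = (j == k).

(** A point of the join lies in some cube of the tiling; that cube meets the join, so closedness
    puts it in [G]. *)
Lemma union_join_closed G : join_closed G -> union G = subcube (join G).
Proof.
move=> cG; apply/eqP; rewrite eqEsubset; apply/andP; split.
  by apply/bigcupsP => k; apply: sub_join.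
apply/subsetP=> x xG; have [k xk] := tiling x.
have xsk : x \in subcube (s_ k) by rewrite xk.
by apply/bigcupP; exists k => //; apply: cG; apply/compatibleP; exists x.
Qed.

(** A point common to the join and to [s_k] lies in some cube of [H], which by the tiling can only
    be [s_k]. This preserves minimality when the loop adds [k]. *)
Lemma compatible_union G H k : G != set0 -> G \subset H ->
  is_subcube (union H) -> compatible (join G) (s_ k) -> k \in H.
Proof.
move=> G0 GH [t Ht] /compatibleP[x xG xk].
have /subsetP/(_ x xG) : subcube (join G) \subset subcube t.
  apply: join_sub => //; rewrite -Ht; apply/bigcupsP => j jG.
  by rewrite /union (bigcup_sup j) // (subsetP GH).
rewrite -Ht => /bigcupP[j jH]; have [i xi] := tiling x.
by move: xk jH; rewrite !xi => /eqP-> jH /eqP<-.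
Qed.

End Subcubes.

(** * The algorithm *)

Lemma code_inj : injective code.
Proof. by case=> [[]|] [[]|]. Qed.

Lemma code_eq2 a : (code a == 2) = (a == None).
Proof. by case: a => [[]|]. Qed.

Section Algorithm.

Variables (n m : nat) (w : m.-tuple (word n)).
Implicit Types (G H : {set 'I_m}) (i j k : 'I_m) (st : state)
  (R : bool -> state -> Prop).

Local Notation wp := (wp (input w) (n + m)).
Local Notation join := (join w).
Local Notation s_ := (tnth w).

Lemma inputE k (l : 'I_n) : input w k l = code (tnth (s_ k) l).
Proof.
by rewrite /input (nth_map (s_ k)) ?size_tuple // -!tnth_nth.
Qed.

Definition sized st : Prop := regs st Rn = n /\ regs st Rm = m.

Definition stores_set st G : Prop :=
  forall k, cells st AG k = (k \in G).

Definition stores_join st G : Prop :=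
  forall l : 'I_n, cells st AJ l = code (tnth (join G) l).

Lemma sized_unchanged c st st' : unchanged c st st' ->
  ~~ writes_reg c Rn -> ~~ writes_reg c Rm -> sized st -> sized st'.
Proof. by move=> [U _] nw mw [en em]; split; rewrite U. Qed.

Lemma stores_set_unchanged c st st' G : unchanged c st st' ->
  ~~ writes_arr c AG -> stores_set st G -> stores_set st' G.
Proof. by move=> [_ U] aw SG k; rewrite U. Qed.

Lemma stores_join_unchanged c st st' G : unchanged c st st' ->
  ~~ writes_arr c AJ -> stores_join st G -> stores_join st' G.
Proof. by move=> [_ U] aw SG k; rewrite U. Qed.

(** Clearing comes first because the array may still hold the set of an earlier pair. *)
Lemma wp_init_G st i j R :
    sized st -> regs st Ri = i -> regs st Rj = j ->
  wp init_G st (fun st' => stores_set st' [set i; j]) R.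
Proof.
move=> [_ em] ei ej; apply: wp_Seq.
apply: (wp_For (lo := 0) (m := m)
  (I := fun p st' => forall a : 'I_m, a < p -> cells st' AG a = 0)) => //=.
- by rewrite leq_addl.
- move=> st' [U _] S0; apply: wp_Seq; do 2!(apply: wp_Store => /=).
  rewrite !U // ei ej => a /=; rewrite !inE orbC.
  by rewrite !val_eqE; do 2!case: eqP => //= _; apply: S0.
move=> k st' _ _ ek S0; apply: wp_Store => /= a ak; rewrite ek val_eqE.
by case: eqP => // /eqP; rewrite -val_eqE /= => ne; apply: S0; lia.
Qed.

Lemma wp_join_G st G i R :
    sized st -> regs st Ri = i -> stores_set st G -> i \in G ->
  wp join_G st (fun st' => stores_join st' G) R.
Proof.
move=> sz ei SG iG; have [en em] := sz.
(* Keeping [i] in every partial set matches the initialization with [s_i] and avoids the junk join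
   of the empty set; meeting [i] again changes nothing. *)
pose P p := i |: [set j in G | j < p].
have P0 p : P p != set0 by apply/set0Pn; exists i; rewrite setU11.
apply: wp_Seq.
apply: (wp_For (lo := 0) (m := n) (I := fun p st' => forall l : 'I_n, l < p ->
  cells st' AJ l = code (tnth (s_ i) l))) => //=.
- by rewrite leq_addr.
2: move=> l st' _ [U _] el S0; apply: wp_Store => /= a ak.
2: rewrite el U // ei val_eqE inputE.
2: by case: eqP => [->//|/eqP]; rewrite -val_eqE /= => ne; apply: S0; lia.
move=> st1 U1 S1.
apply: (wp_For (lo := 0) (m := m) (I := fun p st' => stores_join st' (P p)))
  => //=.
- by have [] := sized_unchanged U1 isT isT sz.
- by rewrite leq_addl.
- have -> : P 0 = [set i] by apply/setP=> j; rewrite !inE andbF orbF.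
  by move=> l; rewrite join1; apply: S1.
- move=> st2 _; have -> // : P m = G; apply/setP => j.
  by rewrite !inE ltn_ord andbT; case: eqP => // ->.
move=> k st2 _ U2 ek S2.
have PS : P k.+1 = if k \in G then k |: P k else P k.
  apply/setP=> j; case: ifP => kG; rewrite !inE ltnS leq_eqVlt val_eqE.
    by case: (j =P k) => [->|_]; rewrite ?kG ?orbT.
  by case: (j =P k) => [->|_] //=; rewrite kG ltnn.
have SG2 : stores_set st2 G.
  exact: (stores_set_unchanged U2 isT (stores_set_unchanged U1 isT SG)).
have sz2 := sized_unchanged U2 isT isT (sized_unchanged U1 isT isT sz).
apply: wp_If => /=; rewrite ek SG2; case: (k \in G) PS => // PS _; last first.
  by apply: wp_Skip; rewrite PS.
(* While [k] is being added, coordinates below [p] are already those of the new join and the others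
   still those of the old one. *)
apply: (wp_For (lo := 0) (m := n) (I := fun p st' => forall l : 'I_n,
  cells st' AJ l = code (tnth (join (if l < p then k |: P k else P k)) l)))
  => //=.
- by case: sz2.
- by rewrite leq_addr.
- by move=> st3 _ S3 l; rewrite S3 PS ltn_ord.
move=> l st3 _ [U3 _] el S3.
have step_l (a : 'I_n) : a != l -> (a < l.+1) = (a < l).
  by rewrite ltnS leq_eqVlt val_eqE => /negPf ->.
apply: wp_If => /=; rewrite el U3 // ek inputE S3 ltnn (inj_eq code_inj) => jk.
  apply: wp_Skip => a /=; case: (a =P l) => [->|/eqP /step_l -> //].
  by rewrite ltnSn joinU1 // jk S3 ltnn.
apply: wp_Store => a /=; rewrite el val_eqE.
case: (a =P l) => [->|/eqP /step_l -> //].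
by rewrite ltnSn joinU1 // (negPf jk).
Qed.

Lemma wp_meets_join st G k R :
    sized st -> regs st Rk = k -> stores_join st G ->
  wp meets_join st (fun st' => regs st' Rmeet = compatible (join G) (s_ k)) R.
Proof.
move=> sz ek SG; have [en em] := sz.
pose ok l := [|| tnth (join G) l == None, tnth (s_ k) l == None
  | tnth (join G) l == tnth (s_ k) l].
apply: wp_Seq; apply: wp_Assign.
apply: (wp_For (lo := 0) (m := n) (I := fun p st' =>
  regs st' Rmeet = [forall l : 'I_n, (l < p) ==> ok l] :> nat)) => //=.
- by rewrite leq_addr.
- have -> : [forall l : 'I_n, (l < 0) ==> ok l] by apply/forallP.
  by [].
- move=> st1 _ ->; congr nat_of_bool; apply: eq_forallb => l.
  by rewrite ltn_ord.
move=> l st1 _ [Ur Ua] el S1.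
have okS : [forall a : 'I_n, (a < l.+1) ==> ok a] =
    [forall a : 'I_n, (a < l) ==> ok a] && ok l.
  apply/forallP/andP => [H|[/forallP H okl] a].
    split; last by have := H l; rewrite ltnSn.
    by apply/forallP=> a; apply/implyP=> al; have := H a; rewrite ltnW.
  by apply/implyP; rewrite ltnS leq_eqVlt val_eqE => /predU1P[->|/(implyP (H a))].
(* The guard detects exactly a conflict at [l]: both letters fixed and different. *)
have okE : holds (input w) st1 (And (And (Not (Eq (Cell AJ Rl) 2))
    (Not (Eq (Input Rk Rl) 2))) (Not (Eq (Cell AJ Rl) (Input Rk Rl)))) = ~~ ok l.
  rewrite /= el Ur //= ek inputE Ua //= SG !code_eq2 (inj_eq code_inj).
  by rewrite /ok !negb_or andbA.
apply: wp_If; rewrite okE ?negbK => okl.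
  by apply: wp_Assign => /=; rewrite okS (negPf okl) andbF.
by apply: wp_Skip => /=; rewrite okS okl andbT.
Qed.

(** Which [k] is picked is left open, so that every resolution of the choices is covered. *)
Definition find_result st G : Prop :=
  regs st Rfound = 0 /\ join_closed w G \/
  regs st Rfound = 1 /\
    exists k, [/\ regs st Rpick = k, k \notin G & compatible (join G) (s_ k)].

Lemma wp_find_s st G R :
    sized st -> stores_set st G -> stores_join st G ->
  wp find_s st (fun st' => find_result st' G) R.
Proof.
move=> sz SG SJ; have [en em] := sz.
pose picked st' := regs st' Rfound = 1 /\
  exists k, [/\ regs st' Rpick = k, k \notin G & compatible (join G) (s_ k)].
apply: wp_Seq; apply: wp_Assign.
apply: (wp_For (lo := 0) (m := m) (I := fun p st' =>
  regs st' Rfound = 0 /\ (forall j, j < p ->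
      compatible (join G) (s_ j) -> j \in G) \/ picked st')) => //=.
- by rewrite leq_addl.
- by left.
- by move=> st1 _ [[f0 H]|]; [left; split=> // k; apply: H | right].
move=> k st1 _ U1 ek S1.
have sz1 : sized st1 by apply: sized_unchanged U1 isT isT _.
have {}SG : stores_set st1 G by apply: stores_set_unchanged U1 isT _.
have {}SJ : stores_join st1 G by apply: stores_join_unchanged U1 isT _.
apply: wp_If => /=; rewrite ek SG eqb0 ?negbK => kG; last first.
  apply: wp_Skip; case: S1 => [[f0 H]|]; [left; split=> // j | by right].
  by rewrite ltnS leq_eqVlt val_eqE => /predU1P[->|/H].
apply: wp_Seq.
apply: wp_conseq (wp_frame (wp_meets_join R sz1 ek SJ)) => // st2 [e2 [U2 _]].
have {}S1 : regs st2 Rfound = 0 /\ (forall j, j < k ->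
    compatible (join G) (s_ j) -> j \in G) \/ picked st2.
  by move: S1; rewrite /picked !U2.
have {}ek : regs st2 Rk = k by rewrite U2.
apply: wp_If => /=; rewrite e2 eqb1 => kc; last first.
  apply: wp_Skip; case: S1 => [[f0 H]|]; [left; split=> // j | by right].
  rewrite ltnS leq_eqVlt val_eqE => /predU1P[->|/H //].
  by rewrite (negPf kc).
apply: wp_If => /= found.
  apply: wp_Seq; do 2!(apply: wp_Assign => /=).
  by right; split=> //; exists k.
(* [Rfound] was already set, so an earlier pick is valid; both branches of the choice leave a valid
   one. *)
have pk : picked st2 by case: S1 => // -[f0]; rewrite f0 in found.
apply: wp_Choice; first by apply: wp_Skip; right.
by apply: wp_Assign; right; split; [case: pk | exists k].
Qed.

(** Minimality is stated against all competitors [H] at once, without first showing that a least one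
    exists. *)
Definition forced i j G : Prop :=
  [/\ i \in G, j \in G & forall H, i \in H -> j \in H ->
      is_subcube (union w H) -> G \subset H].

Definition closure_of i j G : Prop := forced i j G /\ join_closed w G.

Hypothesis tiling : forall x, exists k, forall j, (x \in subcube (s_ j)) = (j == k).

Lemma wp_close_G st i j R :
    sized st -> regs st Ri = i -> stores_set st [set i; j] ->
  wp close_G st
    (fun st' => exists2 G, stores_set st' G & closure_of i j G) R.
Proof.
move=> sz ei SG.
pose ready st' G :=
  [/\ sized st', regs st' Ri = i, stores_set st' G & find_result st' G].
have search st1 G : sized st1 -> regs st1 Ri = i -> stores_set st1 G -> i \in G ->
    wp join_G st1 (fun st2 => wp find_s st2 (ready^~ G) R) R.
  move=> sz1 ei1 SG1 iG.
  apply: wp_conseq (wp_frame (wp_join_G R sz1 ei1 SG1 iG)) => // st2 [SJ U].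
  have sz2 := sized_unchanged U isT isT sz1.
  have SG2 := stores_set_unchanged U isT SG1.
  apply: wp_conseq (wp_frame (wp_find_s R sz2 SG2 SJ)) => // st3 [F U'].
  split=> //; [exact: sized_unchanged U' isT isT sz2 | | ].
    by rewrite U'.1 // U.1.
  exact: stores_set_unchanged U' isT SG2.
(* Each iteration adds a new index, so at most [m - #|G|] of them remain. *)
pose inv v st' := exists G, [/\ #|G| + v = m, forced i j G & ready st' G].
have ijm : #|[set i; j]| <= m by rewrite -[X in _ <= X]card_ord max_card.
apply: wp_Seq; apply: wp_conseq (search _ _ sz ei SG _) => [st1 H|//|]; last first.
  by rewrite !inE eqxx.
apply: wp_Seq; apply: wp_conseq H => // st2 rd2.
apply: wp_conseq (@wp_While _ _ inv (m - #|[set i; j]|) _ _ _ R _ _ _) => //.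
- move=> st3 [[u [G [_ fG [_ _ SG3 [[_ cG]|[found _]]]]]]] /=; last by rewrite found.
  by exists G.
- lia.
- exists [set i; j]; split=> //; first by rewrite subnKC.
  split; rewrite ?inE ?eqxx ?orbT // => H iH jH _.
  by apply/subsetP=> k; rewrite !inE => /orP[] /eqP ->.
move=> u st3 _ [G [cardG fG [sz3 ei3 SG3 F]]] /= /eqP found.
have [[]|[_ [k [ek kG kc]]]] := F; first by rewrite found.
have [iG jG Gmin] := fG.
have cardkG : #|k |: G| = #|G|.+1 by rewrite cardsU1 kG.
have : #|k |: G| <= m by rewrite -[X in _ <= X]card_ord max_card.
rewrite cardkG => ltGm; split; first by lia.
apply: wp_Seq; apply: wp_Store; rewrite /= ek; apply: wp_Seq.
apply: wp_conseq (search _ (k |: G) _ _ _ _) => // [st4||]; last first.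
- by rewrite !inE iG orbT.
- by move=> a /=; rewrite val_eqE !inE; case: eqP.
apply: wp_conseq => // st5 rd5; exists (k |: G); split=> //.
  by rewrite cardkG; lia.
split; rewrite ?inE ?iG ?jG ?orbT // => H iH jH subH.
have GH := Gmin H iH jH subH.
rewrite subUset sub1set GH andbT.
by apply: compatible_union GH subH kc => //; apply/set0Pn; exists i.
Qed.

(** Falling through and returning separate [G = setT] from [G != setT]; a return also keeps the
    array, since the output is read from it. *)
Lemma wp_check_G st G : sized st -> stores_set st G ->
  wp check_G st (fun _ => G = setT)
    (fun r st' => [/\ r = true, G != setT & stores_set st' G]).
Proof.
move=> [en em] SG; apply: wp_Seq; apply: wp_Assign; apply: wp_Seq.
apply: (wp_For (lo := 0) (m := m) (I := fun p st' =>
  regs st' Rproper = [exists k : 'I_m, (k < p) && (k \notin G)] :> nat)) => //=.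
- by rewrite leq_addl.
- by case: existsP => // -[].
- move=> st1 [_ U] e1; apply: wp_If => /=; rewrite e1 eqb1 => ex.
    apply: wp_Return; split=> // [|k]; last by rewrite U //; apply: SG.
    have [k /andP[_ kG]] := existsP ex.
    by apply: contraNneq kG => ->; rewrite inE.
  apply: wp_Skip; apply/setP => k; rewrite inE; apply: contraNT ex => kG.
  by apply/existsP; exists k; rewrite ltn_ord.
move=> k st1 _ [_ U] ek e1; apply: wp_If => /=; rewrite ek U // SG eqb0 => kG.
  apply: wp_Assign => /=; have -> // : [exists j : 'I_m, (j < k.+1) && (j \notin G)].
  by apply/existsP; exists k; rewrite ltnSn.
apply: wp_Skip => /=; rewrite e1; congr nat_of_bool; apply: eq_existsb => j.
rewrite [in RHS]ltnS [in RHS]leq_eqVlt val_eqE.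
by case: (j =P k) => [->|//]; rewrite (negPf kG) !andbF.
Qed.

Definition proper_subcube G : Prop := 1 < #|G| < m /\ is_subcube (union w G).

(** The share of irreducibility certified by a pair that triggers no return. *)
Definition pair_done i j : Prop := forall H,
  i \in H -> j \in H -> is_subcube (union w H) -> H = setT.

Definition verdict (r : bool) st : Prop :=
  if r then exists2 G, stores_set st G & proper_subcube G
  else forall i j, i < j -> pair_done i j.

Lemma wp_pair st i j : i < j -> sized st -> regs st Ri = i -> regs st Rj = j ->
  wp (init_G;; close_G;; check_G) st (fun _ => pair_done i j) verdict.
Proof.
move=> ij sz ei ej; apply: wp_Seq.
apply: wp_conseq (wp_frame (wp_init_G verdict sz ei ej)) => // st1 [SG1 U1].
have sz1 := sized_unchanged U1 isT isT sz.
have ei1 : regs st1 Ri = i by rewrite U1.1.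
apply: wp_Seq; apply: wp_conseq (wp_frame (wp_close_G verdict sz1 ei1 SG1)) => //.
move=> st2 [[G SG2 [[iG jG Gmin] cG]] U2].
have sz2 := sized_unchanged U2 isT isT sz1.
apply: wp_conseq (wp_check_G sz2 SG2) => [st3 GT H iH jH subH|r st3 [-> GT SG3]].
  by apply/eqP; rewrite -subTset -GT; apply: Gmin.
exists G => //; split; last by exists (join G); apply: union_join_closed.
apply/andP; split.
  by apply/card_gt1P; exists i, j; rewrite iG jG -val_eqE neq_ltn ij.
by rewrite -[X in _ < X]card_ord -cardsT proper_card // properEneq GT subsetT.
Qed.

(** The normal postcondition is [False] because the program always ends in a [Return]. *)
Lemma wp_algorithm st : sized st -> wp algorithm st (fun _ => False) verdict.
Proof.
move=> sz; have [en em] := sz; apply: wp_Seq.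
apply: (wp_For (lo := 0) (m := m) (I := fun p _ =>
  forall i j, i < p -> i < j -> pair_done i j)) => //=.
- by rewrite leq_addl.
- by move=> st1 _ H; apply: wp_Return => i j; apply: H.
move=> i st1 _ U1 ei H1.
have sz1 := sized_unchanged U1 isT isT sz.
apply: (wp_For (lo := i.+1) (m := m) (I := fun p _ =>
  forall j, i < j -> j < p -> pair_done i j)) => //=.
- by rewrite ei.
- by case: sz1.
- by rewrite ltn_ord leq_addl.
- by move=> j; lia.
- move=> st2 _ H2 i' j; rewrite ltnS leq_eqVlt val_eqE.
  case/predU1P=> [->|/H1]; last by apply.
  by move/H2; apply.
move=> j st2 ij U2 ej H2.
have sz2 := sized_unchanged U2 isT isT sz1.
have ei2 : regs st2 Ri = i by rewrite U2.1.
apply: wp_conseq (wp_pair ij sz2 ei2 ej) => // _ H3 j' ij'.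
by rewrite ltnS leq_eqVlt val_eqE => /predU1P[->|/H2]; last apply.
Qed.

End Algorithm.

(** * From sets of words to sets of indices *)

Section Partition.

Variables (n m : nat) (w : m.-tuple (word n)).
Hypotheses (w_uniq : uniq w) (w_part : subcube_partition [set s in w]).

(** Disjointness of blocks makes two cubes through [x] equal as sets; injectivity of [subcube] and
    [w_uniq] then make their indices equal. *)
Lemma partition_tiling x :
  exists k, forall j, (x \in subcube (tnth w j)) = (j == k).
Proof.
case/and3P: w_part => /eqP covw trivw _.
have [B /imsetP[s]] : exists2 B, B \in [set subcube s | s in [set s in w]] & x \in B.
  by apply/bigcupP; rewrite -/(cover _) covw inE.
rewrite inE => /tnthP[k ->] -> xk; exists k => j.
apply/idP/eqP => [xj|-> //]; apply/(tuple_uniqP _ w_uniq)/subcube_inj.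
have blk i : subcube (tnth w i) \in [set subcube s | s in [set s in w]].
  by apply/imsetP; exists (tnth w i); rewrite // inE mem_tnth.
by rewrite -(def_pblock trivw (blk j) xj) (def_pblock trivw (blk k) xk).
Qed.

Lemma reduces_indices (H : {set 'I_m}) :
  reduces [set s in w] [set tnth w k | k in H] <-> proper_subcube w H.
Proof.
have inj := tuple_uniqP _ w_uniq.
have cardw : #|[set s in w]| = m by rewrite cardsE (card_uniqP w_uniq) size_tuple.
have sub : [set tnth w k | k in H] \subset [set s in w].
  by apply/subsetP=> s /imsetP[k _ ->]; rewrite inE mem_tnth.
have unionE : \bigcup_(s in [set tnth w k | k in H]) subcube s = union w H.
  by rewrite big_imset //; apply: in2W.
by rewrite /reduces /proper_subcube card_imset // cardw unionE; split=> [[]|[]].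
Qed.

Lemma reducible_indices :
  reducible [set s in w] <-> exists H, proper_subcube w H.
Proof.
split=> [[G redG]|[H]]; last by move/reduces_indices; exists [set tnth w k | k in H].
exists [set k | tnth w k \in G]; apply/reduces_indices.
suff -> : [set tnth w k | k in [set k | tnth w k \in G]] = G by [].
have [/subsetP GF _ _] := redG; apply/setP => s; apply/imsetP/idP => [[k]|sG].
  by rewrite inE => ? ->.
have := GF s sG; rewrite inE => /tnthP[k sk].
by exists k; rewrite // inE -sk.
Qed.

End Partition.

Theorem theorem2p7 :
  exists p : {poly {poly nat}},
  forall (n m : nat) (w : m.-tuple (word n)) (F : {set word n}),
    uniq w -> F = [set s in w] -> subcube_partition F ->
  forall o : nat -> bool,
  exists (t : nat) (a : answer n),
    [/\ t <= (p.[n%:P].[m])%R,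
        output w (exec w o t) = Some a,
        (exists G, a = Reducible G) <-> reducible F,
        forall G, a = Reducible G -> reduces F G
      & a = Irreducible <-> irreducible F].
Proof.
have [p pE] := cost_poly algorithm.
(* Halted configurations are stationary, so the uniform bound itself serves as the time [t],
   whatever [o] is. *)
exists p => n m w _ w_uniq -> w_part o; exists (cost (n + m) algorithm).
have sz : sized n m (start n m).2 by [].
have := wp_run o (wp_algorithm (partition_tiling w_uniq w_part) sz).
rewrite -[(algorithm, _)]/(start n m) -/(exec w o _) -pE.
case: (exec w o _) => -[] //= [] st /= => [[H SH properH]|all_done].
- have redF : reducible [set s in w] by apply/reducible_indices => //; exists H.
  exists (Reducible [set tnth w k | k in H]); split=> //.
  + congr (Some (Reducible _)); apply/setP => s.
    by apply/imsetP/imsetP => -[k kH ->]; exists k => //;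
      move: kH; rewrite inE SH; case: (k \in H).
  + by split=> // _; eexists.
  + by move=> G [<-]; apply/reduces_indices.
- have irrF : irreducible [set s in w].
    (* A reducing [H] has two distinct indices; in whichever order, that pair forces [H = setT],
       against [#|H| < m]. *)
    case/reducible_indices => // H [/andP[/card_gt1P[i [j [iH jH ij]]] ltHm] subH].
    suff HT : H = setT by rewrite HT cardsT card_ord ltnn in ltHm.
    move: ij; rewrite -val_eqE neq_ltn => /orP[] /all_done; exact.
  by exists Irreducible; split=> //; split=> // -[].
Qed.
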